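(* Suppose $\mu_1=\mu_2$ (equivalently $m_1=m_2$, where $m_r=1/\mu_r$) and $h_1\ge h_2$. In the two-stage clearing system described in the context: (A) There exists an optimal policy such that 1. a server completing service at Station 0 chooses to work at Station 2 in all states $(i,1,1,0)$ and $(i,2,0,0)$, for all $i\ge 0$; 2. for states of the form $(i,1,0,1)$, there is $i'$ sufficiently large such that a server completing service at Station 0 chooses to work at Station 1 for all $i\ge i'$. (B) There exists an optimal policy $\pi$ (with $\pi(x)\in\{1,2\}$ the station chosen in state $x$) having a threshold structure in the following sense: 1. (monotone in $i$, from action 2 to action 1) if $(i,j,k,\ell)\in\mathbb{X}_{\widehat D}$ and $\pi(i,j,k,\ell)=1$, then $\pi(i'',j,k,\ell)=1$ for all $i''>i$; 2. if $m>0$, both $(i,j,k,\ell)$ and $(i,j,k-m,\ell+m)$ are in $\mathbb{X}_{\widehat D}$, and $\pi(i,j,k,\ell)=1$, then $\pi(i,j,k-m,\ell+m)=1$; 3. if $m>0$, both $(i,j,k,\ell)$ and $(i,j-m,k,\ell+m)$ are in $\mathbb{X}_{\widehat D}$, and $\pi(i,j,k,\ell)=1$, then $\pi(i,j-m,k,\ell+m)=1$; 4. if $m>0$, both $(i,j,k,\ell)$ and $(i,j+m,k-m,\ell)$ are in $\mathbb{X}_{\widehat D}$, and $\pi(i,j,k,\ell)=1$, then $\pi(i,j+m,k-m,\ell)=1$.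
   Context: Model. A clearing system (no external arrivals, a finite number of initial jobs) has two servers. Each job first receives Phase I service at Station 0 from one server (both servers may work in parallel there). When a Station 0 service completes, the same server, together with the job, must perform Phase II either at Station 1 (action $a=1$; parallel, service begins immediately) or at Station 2 (action $a=2$; a single-service facility handling one job at a time, so the job-server pair may have to queue). A server can start a new Station 0 job only after its current job has completed both phases, and it does so immediately if a job is waiting. Services are non-preemptive, independent and exponential with rates $\mu_0,\mu_1,\mu_2>0$ at Stations 0, 1, 2; $m_r=1/\mu_r$ are the mean service times. Holding costs $h_0,h_1,h_2>0$ per job per unit time are incurred by jobs (waiting or in service) at Stations 0, 1, 2. The objective is to minimize the expected total holding cost until the system is empty. States are $(i,j,k,\ell)$: $i$ jobs in the Station 0 queue (not in service), $j$ in service at Station 0, $k$ in service at Station 1, $\ell$ at Station 2 (waiting or in service). The state space is $\mathbb{X}=\{(i,j,k,\ell)\in\mathbb{Z}_+^4 : (i=0,\ j+k+\ell=1)\text{ or }(i\ge 0,\ j+k+\ell=2)\}$, together with the empty state $(0,0,0,0)$. The decision states (an action is chosen for the job completing Station 0 service) are $\mathbb{X}_D=\{(0,1,0,0)\}\cup\{(i,2,0,0),(i,1,0,1),(i,1,1,0): i\ge 0\}$, and $\mathbb{X}_{\widehat D}=\mathbb{X}_D\setminus\{(0,1,0,0)\}$. Value function. Let $v(i,j,k,\ell)$ be the minimal expected total cost from state $(i,j,k,\ell)$, with $v(0,0,0,0)=0$. With $d=d(j,k,\ell)=j\mu_0+k\mu_1+\min\{\ell,1\}\mu_2$, it satisfies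 (terms with zero coefficient are read as zero): for $i=0$, $$v(0,j,k,\ell)=\tfrac{1}{d}\big[jh_0+kh_1+\ell h_2+k\mu_1 v(0,j,k-1,\ell)+\min\{\ell,1\}\mu_2 v(0,j,k,\ell-1)+j\mu_0\min\{v(0,j-1,k+1,\ell),v(0,j-1,k,\ell+1)\}\big],$$ and for $i\ge 1$, $$v(i,j,k,\ell)=\tfrac{1}{d}\big[(i+j)h_0+kh_1+\ell h_2+k\mu_1 v(i-1,j+1,k-1,\ell)+\min\{\ell,1\}\mu_2 v(i-1,j+1,k,\ell-1)+j\mu_0\min\{v(i,j-1,k+1,\ell),v(i,j-1,k,\ell+1)\}\big].$$ These equations determine $v$ recursively. A policy assigns an action in $\{1,2\}$ to each decision state; it is optimal if it attains the minimum in these equations at every decision state. Thus working at Station 1 (resp. Station 2) is an optimal decision at $(i,j,k,\ell)\in\mathbb{X}_D$ iff $v(i,j-1,k+1,\ell)-v(i,j-1,k,\ell+1)\le 0$ (resp. $\ge 0$). *)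

(* Defs.v *)
From Stdlib Require Import Reals Lra Lia Arith.
Local Open Scope R_scope.

(* A state (i, j, k, l) is passed as four curried naturals: i jobs queued at
   Station 0, j in service at Station 0, k in service at Station 1, l at
   Station 2 (waiting or in service). *)
Definition in_X (i j k l : nat) : Prop :=
  (i = 0 /\ j + k + l = 1)%nat \/ (j + k + l = 2)%nat \/
  (i = 0 /\ j = 0 /\ k = 0 /\ l = 0)%nat.

Definition in_XDhat (i j k l : nat) : Prop :=
  (j = 2 /\ k = 0 /\ l = 0)%nat \/
  (j = 1 /\ k = 0 /\ l = 1)%nat \/
  (j = 1 /\ k = 1 /\ l = 0)%nat.

Definition in_XD (i j k l : nat) : Prop :=
  (i = 0 /\ j = 1 /\ k = 0 /\ l = 0)%nat \/ in_XDhat i j k l.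

Inductive action : Set := Station1 | Station2.

(* Policies are total functions; only their values on [in_XD] matter. *)
Definition policy := nat -> nat -> nat -> nat -> action.

Definition decision_value (v : nat -> nat -> nat -> nat -> R)
    (i j k l : nat) (a : action) : R :=
  match a with
  | Station1 => v i (j - 1)%nat (k + 1)%nat l
  | Station2 => v i (j - 1)%nat k (l + 1)%nat
  end.

Definition total_rate (mu0 mu1 mu2 : R) (j k l : nat) : R :=
  INR j * mu0 + INR k * mu1 + INR (Nat.min l 1) * mu2.

(* (j, k, l) are the in-service counts after the departing job has been removed;
   its server takes the next job waiting at Station 0, if there is one. *)
Definition after_departure (v : nat -> nat -> nat -> nat -> R)
    (i j k l : nat) : R :=
  match i with
  | O => v O j k l
  | S i' => v i' (j + 1)%nat k l
  end.

(* The truncated subtractions k - 1, l - 1 and j - 1 are harmless: each of them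
   is multiplied by a coefficient that vanishes when it truncates. *)
Definition bellman_rhs (mu0 mu1 mu2 h0 h1 h2 : R)
    (v : nat -> nat -> nat -> nat -> R) (i j k l : nat) : R :=
  / total_rate mu0 mu1 mu2 j k l *
  (INR (i + j) * h0 + INR k * h1 + INR l * h2
   + INR k * mu1 * after_departure v i j (k - 1) l
   + INR (Nat.min l 1) * mu2 * after_departure v i j k (l - 1)
   + INR j * mu0 * Rmin (decision_value v i j k l Station1)
                        (decision_value v i j k l Station2)).

(* Values of [v] outside the state space are left unconstrained. *)
Definition is_value_function (mu0 mu1 mu2 h0 h1 h2 : R)
    (v : nat -> nat -> nat -> nat -> R) : Prop :=
  v 0%nat 0%nat 0%nat 0%nat = 0 /\
  forall i j k l : nat, in_X i j k l -> (0 < j + k + l)%nat ->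
    v i j k l = bellman_rhs mu0 mu1 mu2 h0 h1 h2 v i j k l.

Definition optimal (v : nat -> nat -> nat -> nat -> R) (pi : policy) : Prop :=
  forall i j k l : nat, in_XD i j k l ->
    decision_value v i j k l (pi i j k l) =
    Rmin (decision_value v i j k l Station1)
         (decision_value v i j k l Station2).

(* Each transition completes exactly one phase, so the recursion is well-founded
   on the number 2 (i + j) + k + l of phases left. *)
Fixpoint value_fuel (mu0 mu1 mu2 h0 h1 h2 : R) (n : nat)
    (i j k l : nat) : R :=
  match n with
  | O => 0
  | S n' => bellman_rhs mu0 mu1 mu2 h0 h1 h2
              (value_fuel mu0 mu1 mu2 h0 h1 h2 n') i j k l
  end.

Lemma bellman_rhs_ext (mu0 mu1 mu2 h0 h1 h2 : R)
    (v w : nat -> nat -> nat -> nat -> R) (i j k l : nat) :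
  (forall i' j' k' l', in_X i j k l -> in_X i' j' k' l' ->
     (2 * (i' + j') + k' + l' + 1 = 2 * (i + j) + k + l)%nat ->
     v i' j' k' l' = w i' j' k' l') ->
  in_X i j k l ->
  bellman_rhs mu0 mu1 mu2 h0 h1 h2 v i j k l =
  bellman_rhs mu0 mu1 mu2 h0 h1 h2 w i j k l.
Proof.
intros E X; unfold bellman_rhs; f_equal.
assert (K : INR k * mu1 * after_departure v i j (k - 1) l =
            INR k * mu1 * after_departure w i j (k - 1) l).
{ destruct k as [|k]; [simpl; ring|f_equal].
  destruct i as [|i]; simpl; apply E; auto; unfold in_X in *; lia. }
assert (L : INR (Nat.min l 1) * mu2 * after_departure v i j k (l - 1) =
            INR (Nat.min l 1) * mu2 * after_departure w i j k (l - 1)).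
{ destruct l as [|l]; [simpl; ring|f_equal].
  destruct i as [|i]; simpl; apply E; auto; unfold in_X in *; lia. }
rewrite K, L; f_equal.
destruct j as [|j]; [simpl; ring|f_equal].
unfold decision_value; f_equal; apply E; auto; unfold in_X in *; lia.
Qed.

Lemma value_function_exists (mu0 mu1 mu2 h0 h1 h2 : R) :
  is_value_function mu0 mu1 mu2 h0 h1 h2
    (fun i j k l =>
       value_fuel mu0 mu1 mu2 h0 h1 h2 (2 * (i + j) + k + l) i j k l).
Proof.
split; [reflexivity|intros i j k l X P].
destruct (2 * (i + j) + k + l)%nat as [|n] eqn:En; [lia|].
simpl value_fuel; apply bellman_rhs_ext; auto.
intros i' j' k' l' _ _ H; f_equal; lia.
Qed.

Lemma value_function_unique (mu0 mu1 mu2 h0 h1 h2 : R)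
    (v w : nat -> nat -> nat -> nat -> R) :
  is_value_function mu0 mu1 mu2 h0 h1 h2 v ->
  is_value_function mu0 mu1 mu2 h0 h1 h2 w ->
  forall i j k l, in_X i j k l -> v i j k l = w i j k l.
Proof.
intros [v0 Hv] [w0 Hw] i j k l.
remember (2 * (i + j) + k + l)%nat as n eqn:En.
revert i j k l En; induction n as [|n IH]; intros i j k l En X.
- assert (i = 0 /\ j = 0 /\ k = 0 /\ l = 0)%nat as (-> & -> & -> & ->) by lia.
  now rewrite v0, w0.
- assert (P : (0 < j + k + l)%nat) by (unfold in_X in X; lia).
  rewrite (Hv _ _ _ _ X P), (Hw _ _ _ _ X P); apply bellman_rhs_ext; auto.
  intros i' j' k' l' _ X' H; apply IH; [lia|exact X'].
Qed.

(* Main.v *)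
(* When a server leaves a state with i jobs queued and one job remaining in
   Phase II, let y_i be the extra cost if that job is at Station 1 rather than
   at Station 2.  When mu1 = mu2 = mu, the value equations close up on y: with
   g_i = v(i,0,1,1) - v(i,0,0,2), the quantity deciding the action in (i,1,0,1),
     g_i = (h1 - 3 h2 - i h0 + mu y_i) / (2 mu),
     y_0 = (h1 - h2) / mu,  y_(i+1) = (h1 - h2 + mu0 max(0, g_i)) / (mu0 + mu).
   Hence y >= 0, which makes Station 2 optimal in (i,1,1,0) and (i,2,0,0).
   Moreover y_1 <= y_0 and the recursion is monotone, so y and with it g are
   nonincreasing, and the term - i h0 makes g eventually negative. *)
Require Import Defs.
From Stdlib Require Import Reals Lra Lia.
Local Open Scope R_scope.

(** Going through [after_departure] covers both cases at once: at [i = 0] the freed server retires,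
    otherwise it starts the next queued job. *)
Definition departure_gap (v : nat -> nat -> nat -> nat -> R) (i : nat) : R :=
  after_departure v i 0 1 0 - after_departure v i 0 0 1.

Definition blocking_gap (v : nat -> nat -> nat -> nat -> R) (i : nat) : R :=
  v i 0%nat 1%nat 1%nat - v i 0%nat 0%nat 2%nat.

Ltac unfold_value hv i j k l :=
  rewrite (proj2 hv i j k l) by (unfold in_X; lia);
  unfold bellman_rhs, total_rate, decision_value;
  rewrite ?plus_INR; simpl; rewrite ?Rmult_0_l.

Section EqualPhaseTwoRates.

Context (mu0 mu h0 h1 h2 : R) (v : nat -> nat -> nat -> nat -> R).
Context (hmu0 : 0 < mu0) (hmu : 0 < mu) (hh0 : 0 < h0) (hh2 : 0 < h2).
Context (hh : h1 >= h2).
Context (hv : is_value_function mu0 mu mu h0 h1 h2 v).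

(** Both states have rate 2 mu. In each, one of the two possible departures leaves a Station 1 job;
    the other leaves a Station 1 job in the first state and a Station 2 job in the second. *)
Lemma value_020_sub_011 (i : nat) :
  v i 0%nat 2%nat 0%nat - v i 0%nat 1%nat 1%nat =
  (h1 - h2 + mu * departure_gap v i) / (2 * mu).
Proof.
unfold_value hv i 0%nat 2%nat 0%nat;
  unfold_value hv i 0%nat 1%nat 1%nat; unfold departure_gap; field; lra.
Qed.

(** Two jobs at Station 2 leave at rate mu only, against 2 mu for one job at each station. The
    slower exit also delays the [i] queued jobs, whence the term - i h0. *)
Lemma blocking_gapE (i : nat) :
  blocking_gap v i =
  (h1 - 3 * h2 - INR i * h0 + mu * departure_gap v i) / (2 * mu).
Proof.
unfold blocking_gap, departure_gap.
unfold_value hv i 0%nat 1%nat 1%nat;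
  unfold_value hv i 0%nat 0%nat 2%nat; field; lra.
Qed.

Lemma departure_gap0 : departure_gap v 0 = (h1 - h2) / mu.
Proof.
unfold departure_gap, after_departure.
unfold_value hv 0%nat 0%nat 1%nat 0%nat;
  unfold_value hv 0%nat 0%nat 0%nat 1%nat; rewrite (proj1 hv); field; lra.
Qed.

(** The hypothesis makes Station 2 the minimizer in (i,1,1,0). The Phase II departure terms cancel,
    and what remains is v(i,0,1,1) minus its minimum with v(i,0,0,2), that is max(0, g_i). *)
Lemma departure_gapS (i : nat) :
  0 <= departure_gap v i ->
  departure_gap v (S i) =
  (h1 - h2 + mu0 * Rmax 0 (blocking_gap v i)) / (mu0 + mu).
Proof.
intros y_ge0.
assert (ED : 0 <= v i 0%nat 2%nat 0%nat - v i 0%nat 1%nat 1%nat).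
{ rewrite value_020_sub_011; apply Rle_mult_inv_pos; nra. }
unfold departure_gap, blocking_gap, after_departure.
replace (0 + 1)%nat with 1%nat by reflexivity.
unfold_value hv i 1%nat 1%nat 0%nat;
  unfold_value hv i 1%nat 0%nat 1%nat.
rewrite (Rmin_right (v i 0%nat 2%nat 0%nat)) by lra.
unfold Rmin, Rmax; destruct Rle_dec; destruct Rle_dec;
  try (exfalso; lra); try (field; lra).
(* Both comparisons hold only in the tie g_i = 0. *)
replace (v i 0%nat 1%nat 1%nat) with (v i 0%nat 0%nat 2%nat) by lra; field; lra.
Qed.

Lemma departure_gap_ge0 (i : nat) : 0 <= departure_gap v i.
Proof.
induction i as [|i IH].
- rewrite departure_gap0; apply Rle_mult_inv_pos; lra.
- rewrite departure_gapS by exact IH; apply Rle_mult_inv_pos; [|lra].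
  pose proof (Rmax_l 0 (blocking_gap v i)); nra.
Qed.

Lemma blocking_gap_decreasing_step (i : nat) :
  departure_gap v (S i) <= departure_gap v i ->
  blocking_gap v (S i) <= blocking_gap v i.
Proof.
intros H; rewrite !blocking_gapE, S_INR.
apply Rmult_le_compat_r; [|nra].
apply Rlt_le, Rinv_0_lt_compat; lra.
Qed.

Lemma departure_gap_decreasing_step (i : nat) :
  departure_gap v (S i) <= departure_gap v i.
Proof.
induction i as [|i IH].
- rewrite departure_gapS by apply departure_gap_ge0.
  rewrite blocking_gapE, departure_gap0; simpl INR.
  apply Rmult_le_reg_r with (mu * (mu0 + mu)); [nra|].
  replace ((h1 - h2) / mu * (mu * (mu0 + mu)))
    with ((h1 - h2) * (mu0 + mu)) by (field; lra).
  replace (h1 - 3 * h2 - 0 * h0 + mu * ((h1 - h2) / mu))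
    with (2 * (h1 - 2 * h2)) by (field; lra).
  set (g := Rmax _ _).
  (* With denominators cleared, y_1 <= y_0 reduces to this bound; it holds since g_0 = (h1 - 2 h2) /
     mu. *)
  assert (Hg : mu * g <= h1 - h2).
  { unfold g, Rmax; destruct Rle_dec; [|lra].
    replace (mu * _) with (h1 - 2 * h2) by (field; lra); lra. }
  replace (_ / (mu0 + mu) * _) with ((h1 - h2) * mu + mu0 * (mu * g))
    by (field; lra).
  nra.
- rewrite !departure_gapS by apply departure_gap_ge0.
  apply Rmult_le_compat_r; [apply Rlt_le, Rinv_0_lt_compat; lra|].
  apply Rplus_le_compat_l, Rmult_le_compat_l; [lra|].
  apply Rle_max_compat_l, blocking_gap_decreasing_step, IH.
Qed.

Lemma blocking_gap_decreasing (i n : nat) :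
  (i <= n)%nat -> blocking_gap v n <= blocking_gap v i.
Proof.
induction 1 as [|n _ IH]; [lra|].
pose proof (blocking_gap_decreasing_step n (departure_gap_decreasing_step n)).
lra.
Qed.

Lemma departure_gap_le (i : nat) : departure_gap v i <= (h1 - h2) / mu.
Proof.
induction i as [|i IH]; [rewrite departure_gap0; lra|].
pose proof (departure_gap_decreasing_step i); lra.
Qed.

Lemma blocking_gap_eventually_le0 : exists i : nat, blocking_gap v i <= 0.
Proof.
(* As mu y_n <= h1 - h2, the numerator of g_n is at most 2 h1 - 4 h2 - n h0, negative once n h0 > 2
   h1. *)
destruct (INR_unbounded (2 * h1 / h0)) as [n Hn]; exists n.
assert (H : 2 * h1 < INR n * h0).
{ replace (2 * h1) with (2 * h1 / h0 * h0) by (field; lra).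
  now apply Rmult_lt_compat_r. }
assert (Hy : mu * departure_gap v n <= h1 - h2).
{ replace (h1 - h2) with (mu * ((h1 - h2) / mu)) by (field; lra).
  apply Rmult_le_compat_l; [lra|apply departure_gap_le]. }
rewrite blocking_gapE; unfold Rdiv.
assert (0 < / (2 * mu)) by (apply Rinv_0_lt_compat; lra); nra.
Qed.

Lemma station2_optimal_110 (i : nat) :
  v i 0%nat 1%nat 1%nat <= v i 0%nat 2%nat 0%nat.
Proof.
apply Rge_le, Rminus_ge, Rle_ge; rewrite value_020_sub_011.
apply Rle_mult_inv_pos; [|lra].
pose proof (departure_gap_ge0 i); nra.
Qed.

(** The two sides differ by y_(i+1), by definition of [after_departure]. *)
Lemma station2_optimal_200 (i : nat) :
  v i 1%nat 0%nat 1%nat <= v i 1%nat 1%nat 0%nat.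
Proof.
pose proof (departure_gap_ge0 (S i)) as H.
unfold departure_gap in H; simpl in H; lra.
Qed.

Lemma station2_optimal_0100 : v 0%nat 0%nat 0%nat 1%nat <= v 0%nat 0%nat 1%nat 0%nat.
Proof.
pose proof (departure_gap_ge0 0) as H.
unfold departure_gap in H; simpl in H; lra.
Qed.

End EqualPhaseTwoRates.

(** Ties go to Station 1 in (i,1,0,1) and to Station 2 elsewhere, so Station 1 is chosen only in
    states (i,1,0,1). *)
Definition threshold_policy (v : nat -> nat -> nat -> nat -> R) : policy :=
  fun i j k l =>
    match j, k, l with
    | 1%nat, 0%nat, 1%nat =>
        if Rle_dec (blocking_gap v i) 0 then Station1 else Station2
    | _, _, _ => Station2
    end.

Lemma threshold_policy_station1 (v : nat -> nat -> nat -> nat -> R)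
    (i j k l : nat) :
  threshold_policy v i j k l = Station1 <->
  (j = 1 /\ k = 0 /\ l = 1)%nat /\ blocking_gap v i <= 0.
Proof.
split.
- destruct j as [|[|j]], k as [|k], l as [|[|l]]; try discriminate.
  simpl; destruct Rle_dec; [auto|discriminate].
- intros [(-> & -> & ->) H]; simpl; now destruct Rle_dec.
Qed.

Lemma threshold_policy_optimal (mu0 mu h0 h1 h2 : R)
    (v : nat -> nat -> nat -> nat -> R) :
  0 < mu0 -> 0 < mu -> h1 >= h2 ->
  is_value_function mu0 mu mu h0 h1 h2 v ->
  optimal v (threshold_policy v).
Proof.
intros hmu0 hmu hh hv i j k l [X|[X|[X|X]]].
- destruct X as (-> & -> & -> & ->); symmetry; apply Rmin_right.
  now apply (station2_optimal_0100 mu0 mu h0 h1 h2).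
- destruct X as (-> & -> & ->); symmetry; apply Rmin_right.
  now apply (station2_optimal_200 mu0 mu h0 h1 h2).
- destruct X as (-> & -> & ->); unfold threshold_policy, blocking_gap.
  destruct Rle_dec; unfold decision_value; simpl; symmetry;
    [apply Rmin_left|apply Rmin_right]; lra.
- destruct X as (-> & -> & ->); symmetry; apply Rmin_right.
  now apply (station2_optimal_110 mu0 mu h0 h1 h2).
Qed.

Theorem theorem2p3 (mu0 mu1 mu2 h0 h1 h2 : R)
    (hmu0 : 0 < mu0) (hmu1 : 0 < mu1) (hmu2 : 0 < mu2)
    (hh0 : 0 < h0) (hh1 : 0 < h1) (hh2 : 0 < h2)
    (v : nat -> nat -> nat -> nat -> R)
    (hv : is_value_function mu0 mu1 mu2 h0 h1 h2 v)
    (hmu : mu1 = mu2) (hh : h1 >= h2) :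
  (exists pi : policy,
      optimal v pi /\
      (forall i : nat, pi i 1%nat 1%nat 0%nat = Station2 /\
                       pi i 2%nat 0%nat 0%nat = Station2) /\
      (exists i' : nat, forall i : nat, (i' <= i)%nat ->
                       pi i 1%nat 0%nat 1%nat = Station1)) /\
  (exists pi : policy,
      optimal v pi /\
      (forall i j k l : nat,
          in_XDhat i j k l -> pi i j k l = Station1 ->
          forall i'' : nat, (i < i'')%nat -> pi i'' j k l = Station1) /\
      (forall i j k l m : nat,
          (0 < m)%nat -> (m <= k)%nat ->
          in_XDhat i j k l -> in_XDhat i j (k - m) (l + m) ->
          pi i j k l = Station1 -> pi i j (k - m)%nat (l + m)%nat = Station1) /\
      (forall i j k l m : nat,
          (0 < m)%nat -> (m <= j)%nat ->
          in_XDhat i j k l -> in_XDhat i (j - m) k (l + m) ->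
          pi i j k l = Station1 -> pi i (j - m)%nat k (l + m)%nat = Station1) /\
      (forall i j k l m : nat,
          (0 < m)%nat -> (m <= k)%nat ->
          in_XDhat i j k l -> in_XDhat i (j + m) (k - m) l ->
          pi i j k l = Station1 -> pi i (j + m)%nat (k - m)%nat l = Station1)).
Proof.
subst mu2.
assert (opt : optimal v (threshold_policy v))
  by now apply (threshold_policy_optimal mu0 mu1 h0 h1 h2).
assert (mono : forall i n, (i <= n)%nat -> blocking_gap v n <= blocking_gap v i)
  by now apply (blocking_gap_decreasing mu0 mu1 h0 h1 h2).
split; exists (threshold_policy v); (split; [exact opt|]).
- split; [now split|].
  destruct (blocking_gap_eventually_le0 mu0 mu1 h0 h1 h2 v) as [n Hn]; auto.
  exists n; intros i Hi; apply threshold_policy_station1; split; [auto|].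
  specialize (mono n i Hi); lra.
- split; [|split; [|split]].
  + intros i j k l _ H i'' Hi.
    apply threshold_policy_station1 in H as [H g_le0].
    apply threshold_policy_station1; split; [exact H|].
    specialize (mono i i''); assert (i <= i'')%nat by lia; intuition lra.
  (* Choosing Station 1 forces [k = 0], against [0 < m <= k]. *)
  + intros i j k l m m0 mk _ _ H.
    apply threshold_policy_station1 in H as [H _]; lia.
  (* Here [j = m = 1], so the target has [j - m = 0] and is no decision state. *)
  + intros i j k l m m0 mj _ X H.
    apply threshold_policy_station1 in H as [H _]; unfold in_XDhat in X; lia.
  + intros i j k l m m0 mk _ _ H.
    apply threshold_policy_station1 in H as [H _]; lia.
Qed.
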